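(* The problem $\mathsf{G}_\geq$ is computable relative to the halting problem.
   Context: $\varphi$ is a fixed standard (acceptable) Gödel numbering of the partial computable functions $\subseteq\mathbb N\to\mathbb N$. For a (total) computable sequence $p\in\mathbb N^{\mathbb N}$ let $\mathsf{G}(p)=\{i\in\mathbb N:\varphi_i=p\}$ and $\mathsf{K}(p)=\min\mathsf{G}(p)$. The problem $\mathsf{G}_\geq:\subseteq\mathbb N^{\mathbb N}\times\mathbb N\rightrightarrows\mathbb N$ is the partial multivalued map $\mathsf{G}_\geq(p,m)=\mathsf{G}(p)$ with domain $\{(p,m):p\text{ computable},\ m\geq\mathsf{K}(p)\}$ (so the output index need not satisfy the bound $m$). A problem is computable relative to the halting problem $\emptyset'$ if it has a realizer that is computable with oracle $\emptyset'$; here this means there is a partial function $F:\subseteq\mathbb N^{\mathbb N}\times\mathbb N\to\mathbb N$, computable (by a Turing machine that reads $p$ as an oracle/infinite input) relative to $\emptyset'$, with $F(p,m)\in\mathsf{G}_\geq(p,m)$ for all $(p,m)\in\mathrm{dom}(\mathsf{G}_\geq)$. *)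

(* Defs.v *)
From mathcomp Require Import all_boot.
From mathcomp Require Import boolp classical_sets.

Set Implicit Arguments.
Unset Strict Implicit.
Unset Printing Implicit Defensive.

Local Open Scope classical_set_scope.

(* Partial functions to [nat] are rendered as functions to [option nat], with
   [None] for "undefined". *)

(* Kleene's partial recursive functions with oracles: [rec Q n] is the type of
   programs of arity [n] that can call oracles named by the elements of [Q].
   In [Prec f g] the recursion is on the first argument, and [g] receives the
   counter, the previous value and the remaining arguments, in this order.
   [Mu f] minimizes over the first argument of [f]. *)
Inductive rec (Q : Type) : nat -> Type :=
| Zero n : rec Q n
| Succ : rec Q 1
| Proj n (i : 'I_n) : rec Q n
| Ask (q : Q) : rec Q 1
| Comp m n (f : rec Q m) (g : 'I_m -> rec Q n) : rec Q n
| Prec n (f : rec Q n) (g : rec Q n.+2) : rec Q n.+1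
| Mu n (f : rec Q n.+1) : rec Q n.

Arguments Zero {Q n}.
Arguments Succ {Q}.
Arguments Proj {Q n} i.
Arguments Ask {Q} q.

Fixpoint iter_graph (base : nat -> Prop) (step : nat -> nat -> nat -> Prop)
    (k y : nat) : Prop :=
  if k is k'.+1 then exists2 z, iter_graph base step k' z & step k' z y
  else base y.

(* [eval O c v y]: on input [v] and with oracles [O], the program [c] halts
   with output [y]. *)
Fixpoint eval (Q : Type) (O : Q -> nat -> nat) (n : nat) (c : rec Q n) :
    n.-tuple nat -> nat -> Prop :=
  match c in rec _ n return n.-tuple nat -> nat -> Prop with
  | Zero _ => fun _ y => y = 0
  | Succ => fun v y => y = (thead v).+1
  | Proj _ i => fun v y => y = tnth v i
  | Ask q => fun v y => y = O q (thead v)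
  | Comp m _ f g => fun v y =>
      exists2 w : m.-tuple nat,
        (forall i, eval O (g i) v (tnth w i)) & eval O f w y
  | Prec _ f g => fun v y =>
      iter_graph (eval O f [tuple of behead v])
        (fun k z => eval O g [tuple of k :: z :: behead v]) (thead v) y
  | Mu _ f => fun v y =>
      eval O f [tuple of y :: v] 0 /\
      forall k, k < y -> exists z, eval O f [tuple of k :: v] z.+1
  end.

Definition no_oracle (q : void) : nat -> nat := match q with end.

Definition partial_computable1 (f : nat -> option nat) : Prop :=
  exists c : rec void 1,
    forall x y, f x = Some y <-> eval no_oracle c [tuple x] y.

Definition partial_computable2 (f : nat -> nat -> option nat) : Prop :=
  exists c : rec void 2,
    forall x1 x2 y, f x1 x2 = Some y <-> eval no_oracle c [tuple x1; x2] y.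

Definition computable (f : nat -> nat) : Prop :=
  partial_computable1 (fun x => Some (f x)).

(* Acceptable Goedel numberings: the universal function of [phi] is partial
   computable, and the smn property holds.  The latter, applied to a [psi] that
   ignores its first argument, makes every partial computable function some
   [phi i]. *)
Definition acceptable (phi : nat -> nat -> option nat) : Prop :=
  partial_computable2 phi /\
  forall psi : nat -> nat -> option nat, partial_computable2 psi ->
    exists2 s : nat -> nat, computable s & forall i x, phi (s i) x = psi i x.

Definition halting (phi : nat -> nat -> option nat) : set nat :=
  [set i | phi i i <> None].

Definition charf (A : set nat) (x : nat) : nat := `[< A x >].

(* Partial multivalued maps; the values outside [pdom] are irrelevant. *)
Record problem (X Y : Type) := Problem { pdom : set X; pval : X -> set Y }.

Inductive oracle_name := Input | Aux.

Definition oracles (p : nat -> nat) (A : set nat) (q : oracle_name) :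
    nat -> nat :=
  match q with Input => p | Aux => charf A end.

(* A partial functional on Baire space times [nat] computed, uniformly in the
   sequence [p], by one program that accesses [p] as an oracle, and which may
   moreover query membership in [A]. *)
Definition functional_computable_in (A : set nat)
    (F : (nat -> nat) * nat -> option nat) : Prop :=
  exists c : rec oracle_name 1,
    forall p m y, F (p, m) = Some y <-> eval (oracles p A) c [tuple m] y.

Definition realizes (X Y : Type) (F : X -> option Y) (P : problem X Y) : Prop :=
  forall x, pdom P x -> exists2 y, F x = Some y & pval P x y.

Definition computable_relative_to (A : set nat)
    (P : problem ((nat -> nat) * nat) nat) : Prop :=
  exists2 F, functional_computable_in A F & realizes F P.

Definition G (phi : nat -> nat -> option nat) (p : nat -> nat) : set nat :=
  [set i | forall x, phi i x = Some (p x)].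

(* The minimum of [A], with default value 0 when [A] is empty. *)
Definition min_set (A : set nat) : nat :=
  xget 0 [set k | A k /\ forall i, A i -> k <= i].

Definition K (phi : nat -> nat -> option nat) (p : nat -> nat) : nat :=
  min_set (G phi p).

Definition G_ge (phi : nat -> nat -> option nat) :
    problem ((nat -> nat) * nat) nat :=
  Problem [set pm | computable pm.1 /\ K phi pm.1 <= pm.2]
          (fun pm => G phi pm.1).

(* Main.v *)
Require Import Defs.
From mathcomp Require Import all_boot.
From mathcomp Require Import boolp classical_sets.

Set Implicit Arguments.
Unset Strict Implicit.
Unset Printing Implicit Defensive.

(** The idea is to merge candidate indices two at a time.  Given [i] and [j], at
    least one of them an index of [p], ask the halting problem whether [phi i]
    and [phi j] ever halt at a common point with different values.

    If they do, search for such a point [x].  The value of [phi i] at [x] is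
    known once the point is found, so compare it with [p x]: if they are equal
    then [phi j] differs from [p] at [x] and [i] is the index of [p], otherwise
    [j] is.  If they do not, then the function that runs [phi i x] and [phi j x]
    in parallel and returns the value of the one that halts first agrees with
    both where they are defined.  As one of them is the total function [p], it
    is [p], and the smn property gives an index of it.  Both cases are contained
    in [merge_indices].

    Merging 0, 1, ..., [m] in succession yields an index of [p], because the
    correct index [K phi p] is among these numbers and, once it has been merged,
    the result stays correct.

    Most of the work is to exhibit the programs.  [recursive O n f] says that
    one program computes the total function [f] relative to each oracle of the
    family [O], and it is closed under composition, primitive recursion and
    search.  The stepwise evaluation [run] is such a function of the number of
    steps and the input, which gives dovetailing, and questions to the halting
    problem, their programs. *)

(** * Bounded minimization *)

(** The counter stops at the first point where [p] fails.  This form, rather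
    than a search through a list, is a primitive recursion as it stands. *)
Definition least (p : nat -> bool) t :=
  iteri t (fun _ z => if p z then z.+1 else z) 0.

Lemma leastP (p : nat -> bool) t :
  [/\ least p t <= t, forall k, k < least p t -> p k
    & least p t < t -> ~~ p (least p t)].
Proof.
elim: t => [|t [IH1 IH2 IH3]] //=; rewrite -/(least p t).
case: ifPn => [pz | npz]; last by split=> //; apply: leqW.
split=> [|k|] //; first by rewrite ltnS leq_eqVlt => /predU1P[-> //|/IH2].
by rewrite ltnS => /IH3; rewrite pz.
Qed.

Lemma least_eq (p : nat -> bool) t y :
  y <= t -> (forall k, k < y -> p k) -> ~~ p y -> least p t = y.
Proof.
move=> le_yt py npy; have [_ lt_p le_p] := leastP p t.
case: (ltngtP (least p t) y) => // [lt_y | /lt_p]; last by rewrite (negPf npy).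
by move/negP: (le_p (leq_trans lt_y le_yt)) => /(_ (py _ lt_y)).
Qed.

(** * Total computable functions relative to a family of oracles *)

Section Closure.

Variables (D Q : Type) (O : D -> Q -> nat -> nat).

(** The program does not depend on the parameter [d] of the oracle; with the
    sequences for [d] this is computability uniform in the sequence.  The
    arguments form a plain sequence, so that extending it by [cons] and shifting
    variables are conversions; only its values on sequences of length [n]
    matter. *)
Definition recursive n (f : D -> seq nat -> nat) : Prop :=
  exists c : rec Q n, forall d (v : n.-tuple nat) y,
    eval (O d) c v y <-> y = f d v.

Lemma recursive_ext n f g :
  (forall d v, size v = n -> f d v = g d v) -> recursive n f -> recursive n g.
Proof.
by move=> fg [c cP]; exists c => d v y; rewrite cP fg ?size_tuple.
Qed.

Lemma recursive_var n i : i < n -> recursive n (fun _ v => nth 0 v i).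
Proof.
move=> lt_in; exists (Proj (Ordinal lt_in)) => d v y /=.
by rewrite (tnth_nth 0).
Qed.

Lemma recursive_ask q : recursive 1 (fun d v => O d q (nth 0 v 0)).
Proof. by exists (Ask q) => d v y /=; rewrite /thead (tnth_nth 0). Qed.

Lemma recursive_comp n (f : D -> seq nat -> nat)
    (gs : seq (D -> seq nat -> nat)) :
  recursive (size gs) f ->
  (forall i, i < size gs -> recursive n (nth (fun _ _ => 0) gs i)) ->
  recursive n (fun d v => f d [seq g d v | g <- gs]).
Proof.
move=> [cf cfP] gsP.
have /choice[cg cgP] (i : 'I_(size gs)) : exists c : rec Q n, forall d
    (v : n.-tuple nat) y, eval (O d) c v y <-> y = nth (fun _ _ => 0) gs i d v.
  exact: gsP.
exists (Comp cf cg) => d v y /=; split.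
  move=> [w wP /cfP ->]; congr (f d _).
  apply: (@eq_from_nth _ 0); rewrite size_tuple ?size_map // => i lt_i.
  rewrite (nth_map (fun _ _ => 0)) //.
  by have /cgP := wP (Ordinal lt_i); rewrite (tnth_nth 0).
move=> ->.
exists (map_tuple (fun g : D -> seq nat -> nat => g d v) (in_tuple gs));
  last by apply/cfP.
move=> i; apply/cgP; rewrite tnth_map.
by rewrite (tnth_nth (fun _ _ => 0)).
Qed.

Lemma recursive_app1 (F : D -> nat -> nat) n a :
  recursive 1 (fun d v => F d (nth 0 v 0)) -> recursive n a ->
  recursive n (fun d v => F d (a d v)).
Proof. by move=> FP aP; refine (recursive_comp (gs := [:: a]) FP _); case. Qed.

Lemma recursive_app2 (F : D -> nat -> nat -> nat) n a b :
  recursive 2 (fun d v => F d (nth 0 v 0) (nth 0 v 1)) ->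
  recursive n a -> recursive n b ->
  recursive n (fun d v => F d (a d v) (b d v)).
Proof.
by move=> FP aP bP; refine (recursive_comp (gs := [:: a; b]) FP _); do 2?case.
Qed.

Lemma recursive_app3 (F : D -> nat -> nat -> nat -> nat) n a b c :
  recursive 3 (fun d v => F d (nth 0 v 0) (nth 0 v 1) (nth 0 v 2)) ->
  recursive n a -> recursive n b -> recursive n c ->
  recursive n (fun d v => F d (a d v) (b d v) (c d v)).
Proof.
move=> FP aP bP cP.
by refine (recursive_comp (gs := [:: a; b; c]) FP _); do 3?case.
Qed.

(** Substitution under binders: the innermost [k] variables of the context are
    replaced by the terms [gs] and the other [n] are left in place. *)
Lemma recursive_env n k f gs :
  recursive (size gs + n) f ->
  (forall i, i < size gs -> recursive (k + n) (nth (fun _ _ => 0) gs i)) ->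
  recursive (k + n)
    (fun d v => f d ([seq g d v | g <- gs] ++ iter k behead v)).
Proof.
move=> fP gsP.
pose hs := [seq (fun (_ : D) v => nth 0 v i) | i <- iota k n].
have size_hs : size hs = n by rewrite size_map size_iota.
have hP : recursive (k + n) (fun d v => f d [seq g d v | g <- gs ++ hs]).
  apply: recursive_comp => [|i]; rewrite size_cat size_hs // nth_cat.
  case: (ltnP i (size gs)) => [/gsP //|le_i lt_i].
  have lt_in : i - size gs < n by rewrite ltn_subLR.
  rewrite (nth_map 0) ?size_iota // nth_iota //.
  by apply: recursive_var; rewrite ltn_add2l.
apply: recursive_ext hP => d v size_v; rewrite map_cat; congr (f d (_ ++ _)).
have -> : iter k behead v = drop k v.
  by elim: (k) => [|j /= ->]; rewrite ?drop0 // -drop1 drop_drop add1n.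
apply: (@eq_from_nth _ 0) => [|i]; rewrite size_map size_hs.
  by rewrite size_drop size_v addKn.
move=> lt_in; rewrite -map_comp (nth_map 0) ?size_iota //=.
by rewrite nth_iota // nth_drop.
Qed.

Lemma recursive_behead n f :
  recursive n f -> recursive n.+1 (fun d v => f d (behead v)).
Proof. by move=> fP; apply: (@recursive_env n 1 f [::]). Qed.

Lemma recursive_succ n a :
  recursive n a -> recursive n (fun d v => (a d v).+1).
Proof.
apply: (@recursive_app1 (fun _ x => x.+1)).
by exists Succ => d v y /=; rewrite /thead (tnth_nth 0).
Qed.

Lemma recursive_const n k : recursive n (fun _ _ => k).
Proof.
by elim: k => [|k IHk]; [exists Zero | apply: recursive_succ].
Qed.

Lemma recursive_prec n (a b s : D -> seq nat -> nat) :
  recursive n a -> recursive n b -> recursive n.+2 s ->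
  recursive n
    (fun d v => iteri (a d v) (fun k z => s d [:: k, z & v]) (b d v)).
Proof.
move=> aP [cb cbP] [cs csP].
pose h d w := iteri (nth 0 w 0)
    (fun k z => s d [:: k, z & behead w]) (b d (behead w)).
have hP : recursive n.+1 h.
  exists (Prec cb cs) => d v y; rewrite /= /h /thead (tnth_nth 0) /=.
  elim: (nth 0 v 0) y => [|k IHk] y /=; first exact: cbP.
  by split=> [[z /IHk -> /csP] | ->] //; eexists; [apply/IHk | apply/csP].
by apply: (@recursive_env n 0 h [:: a]) => //; case.
Qed.

Lemma recursive_if n (a : D -> seq nat -> bool) b c :
  recursive n a -> recursive n b -> recursive n c ->
  recursive n (fun d v => if a d v then b d v else c d v).
Proof.
move=> aP bP cP.
have := recursive_prec aP cP (recursive_behead (recursive_behead bP)).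
by apply: recursive_ext => d v _ /=; case: (a d v).
Qed.

Lemma recursive_pred n a :
  recursive n a -> recursive n (fun d v => (a d v).-1).
Proof.
move=> aP; have := recursive_prec aP (recursive_const n 0)
  (@recursive_var n.+2 0 isT).
by apply: recursive_ext => d v _ /=; case: (a d v).
Qed.

Lemma recursive_add n a b : recursive n a -> recursive n b ->
  recursive n (fun d v => a d v + b d v).
Proof.
move=> aP bP.
have := recursive_prec aP bP (recursive_succ (@recursive_var n.+2 1 isT)).
by apply: recursive_ext => d v _ /=; elim: (a d v) => //= k ->.
Qed.

Lemma recursive_sub n a b : recursive n a -> recursive n b ->
  recursive n (fun d v => a d v - b d v).
Proof.
move=> aP bP.
have := recursive_prec bP aP (recursive_pred (@recursive_var n.+2 1 isT)).
apply: recursive_ext => d v _ /=.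
by elim: (b d v) => [|k /= ->]; rewrite ?subn0 ?subnS.
Qed.

Lemma recursive_mul n a b : recursive n a -> recursive n b ->
  recursive n (fun d v => a d v * b d v).
Proof.
move=> aP bP.
have := recursive_prec aP (recursive_const n 0)
  (recursive_add (recursive_behead (recursive_behead bP))
    (@recursive_var n.+2 1 isT)).
by apply: recursive_ext => d v _ /=; elim: (a d v) => //= k ->.
Qed.

Lemma recursive_pos n a :
  recursive n a -> recursive n (fun d v => 0 < a d v).
Proof.
move=> aP; have := recursive_prec aP (recursive_const n 0)
  (recursive_const n.+2 1).
by apply: recursive_ext => d v _ /=; case: (a d v).
Qed.

Lemma recursive_neg n (a : D -> seq nat -> bool) :
  recursive n a -> recursive n (fun d v => ~~ a d v).
Proof.
move=> aP; have := recursive_if aP (recursive_const n 0) (recursive_const n 1).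
by apply: recursive_ext => d v _; case: (a d v).
Qed.

Lemma recursive_and n (a b : D -> seq nat -> bool) :
  recursive n a -> recursive n b -> recursive n (fun d v => a d v && b d v).
Proof.
move=> aP bP; have := recursive_if aP bP (recursive_const n 0).
by apply: recursive_ext => d v _; case: (a d v).
Qed.

Lemma recursive_or n (a b : D -> seq nat -> bool) :
  recursive n a -> recursive n b -> recursive n (fun d v => a d v || b d v).
Proof.
move=> aP bP; have := recursive_if aP (recursive_const n 1) bP.
by apply: recursive_ext => d v _; case: (a d v).
Qed.

Lemma recursive_leq n a b : recursive n a -> recursive n b ->
  recursive n (fun d v => a d v <= b d v).
Proof.
move=> aP bP; have := recursive_neg (recursive_pos (recursive_sub aP bP)).
by apply: recursive_ext => d v _; rewrite subn_gt0 -leqNgt.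
Qed.

Lemma recursive_eq n a b : recursive n a -> recursive n b ->
  recursive n (fun d v => a d v == b d v).
Proof.
move=> aP bP; have := recursive_and (recursive_leq aP bP) (recursive_leq bP aP).
by apply: recursive_ext => d v _; rewrite eqn_leq.
Qed.

Lemma recursive_least n a (p : D -> seq nat -> bool) :
  recursive n a -> recursive n.+1 p ->
  recursive n (fun d v => least (fun k => p d (k :: v)) (a d v)).
Proof.
move=> aP pP; have var1 := @recursive_var n.+2 1 isT.
have zP : recursive n.+2 (fun d w => p d (nth 0 w 1 :: behead (behead w))).
  by refine (@recursive_env n 2 _ [:: fun _ w => nth 0 w 1] pP _); case.
exact: recursive_prec aP (recursive_const n 0)
  (recursive_if zP (recursive_succ var1) var1).
Qed.

(** [Mu] looks for a zero and the truth value of a failing test is zero, so the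
    program minimizes the negation of [g]. *)
Lemma eval_least n (g : D -> seq nat -> bool) :
  recursive n.+1 g -> exists c : rec Q n, forall d (v : n.-tuple nat) y,
    eval (O d) c v y <-> g d (y :: v) /\ forall k, k < y -> ~~ g d (k :: v).
Proof.
move=> /recursive_neg[c cP]; exists (Mu c) => d v y /=.
split=> [[/cP /= gy lt_y] | [gy lt_y]].
  split=> [|k /lt_y[z /cP /=]]; first by case: (g d _) gy.
  by case: (g d _).
split=> [|k /lt_y gk]; first by apply/cP; rewrite /= gy.
by exists 0; apply/cP; rewrite /= gk.
Qed.

Lemma recursive_search n (g : D -> seq nat -> bool) :
  recursive n.+1 g -> (forall d v, exists t, g d (t :: v)) ->
  exists2 f, recursive n f & forall d v, g d (f d v :: v).
Proof.
move=> /eval_least[c cP] ex_g.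
exists (fun d v => ex_minn (ex_g d v)); last by move=> d v; case: ex_minnP.
exists c => d v y; rewrite cP; case: ex_minnP => t gt min_t.
split=> [[gy lt_y] | ->].
  apply/eqP; rewrite eqn_leq (min_t _ gy) andbT leqNgt; apply/negP=> /lt_y.
  by rewrite gt.
by split=> // k; rewrite ltnNge; apply: contra => /min_t.
Qed.

Lemma recursive_all_pos n (I : Type) (F : I -> D -> seq nat -> nat) s :
  (forall i, recursive n (F i)) ->
  recursive n (fun d v => all (leq 1) [seq F i d v | i <- s]).
Proof.
move=> FP; elim: s => [|i s IHs]; first exact: (recursive_const n 1).
exact: recursive_and (recursive_pos (FP i)) IHs.
Qed.

End Closure.

(** * From computations without oracle to computations with oracles *)

Fixpoint no_ask Q n (c : rec void n) : rec Q n :=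
  match c with
  | Zero _ => Zero
  | Succ => Succ
  | Proj _ i => Proj i
  | Ask q => match q with end
  | Comp _ _ f g => Comp (no_ask Q f) (fun i => no_ask Q (g i))
  | Prec _ f g => Prec (no_ask Q f) (no_ask Q g)
  | Mu _ f => Mu (no_ask Q f)
  end.

Lemma iter_graph_iff base base' step step' k y :
  (forall y, base y <-> base' y) ->
  (forall k z y, step k z y <-> step' k z y) ->
  iter_graph base step k y <-> iter_graph base' step' k y.
Proof.
move=> baseE stepE; elim: k y => [|k IHk] y //=.
by split=> -[z /IHk kz /stepE zy]; exists z.
Qed.

Lemma eval_no_ask Q (O : Q -> nat -> nat) n (c : rec void n) v y :
  eval O (no_ask Q c) v y <-> eval no_oracle c v y.
Proof.
elim: c v y => // [m k f IHf g IHg | k f IHf g IHg | k f IHf] v y /=.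
- by split=> -[w wP /IHf fw]; exists w => // i; apply/IHg.
- by apply: iter_graph_iff => *; [apply: IHf | apply: IHg].
- split=> -[/IHf fy lt_y]; split=> // j /lt_y[z /IHf fz]; by exists z.
Qed.

Definition recursive0 := recursive (fun _ : unit => no_oracle).

Lemma recursive0_recursive D Q (O : D -> Q -> nat -> nat) n f :
  recursive0 n (fun _ => f) -> recursive O n (fun _ => f).
Proof.
move=> [c cP]; exists (no_ask Q c) => d v y.
by rewrite eval_no_ask (cP tt).
Qed.

(** * Stepwise evaluation *)

Section Clock.

Variables (Q : Type) (O : Q -> nat -> nat).

(** The result is 0 for a computation that has not halted within [t] steps and
    [y.+1] for one that has halted with output [y].  The bound [t] only limits
    the minimizations; this suffices to make the evaluation total.  In the
    minimization, the test that the value is above 1 continues the search past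
    the points where [f] has halted with a nonzero output. *)
Fixpoint run n (c : rec Q n) (t : nat) (v : seq nat) : nat :=
  match c with
  | Zero _ => 1
  | Succ => (nth 0 v 0).+2
  | Proj _ i => (nth 0 v i).+1
  | Ask q => (O q (nth 0 v 0)).+1
  | Comp m _ f g =>
      let w := [seq run (g i) t v | i <- enum 'I_m] in
      if all (leq 1) w then run f t (map predn w) else 0
  | Prec _ f g =>
      iteri (nth 0 v 0)
        (fun k z => if 0 < z then run g t [:: k, z.-1 & behead v] else 0)
        (run f t (behead v))
  | Mu _ f =>
      let y := least (fun k => 1 < run f t (k :: v)) t in
      if run f t (y :: v) == 1 then y.+1 else 0
  end.

(** Monotonicity in [t] allows a common bound for finitely many computations:
    the subcomputations of one program, or two programs to be compared. *)
Lemma run_mono n (c : rec Q n) t t' v :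
  t <= t' -> 0 < run c t v -> run c t' v = run c t v.
Proof.
move=> le_tt'; elim: c v => // [m k f IHf g IHg | k f IHf g IHg | k f IHf] v /=.
- case: ifP => // /allP w_pos f_pos.
  suff -> : [seq run (g i) t' v | i <- enum 'I_m] =
            [seq run (g i) t v | i <- enum 'I_m].
    by case: allP => // _; apply: IHf.
  by apply/eq_in_map => i i_in; apply/IHg/w_pos/map_f.
- elim: (nth 0 v 0) => [|j IHj] /=; first exact: IHf.
  by case: ifP => // z_pos; rewrite (IHj z_pos) z_pos; apply: IHg.
- case: (leastP (fun k => 1 < run f t (k :: v)) t) => le_t lt_run _.
  case: eqP => // y_run _.
  have y_run' : run f t' (least (fun k => 1 < run f t (k :: v)) t :: v) = 1.
    by rewrite IHf ?y_run.
  rewrite (@least_eq _ _ (least (fun k => 1 < run f t (k :: v)) t)).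
  + by rewrite y_run'.
  + exact: leq_trans le_tt'.
  + by move=> j /lt_run lt_j; rewrite IHf // ltnW.
  + by rewrite y_run'.
Qed.

Lemma run_sound n (c : rec Q n) t (v : n.-tuple nat) y :
  run c t v = y.+1 -> eval O c v y.
Proof.
elim: c v y => [k||k i|q|m k f IHf g IHg|k f IHf g IHg|k f IHf] v y /=.
- by case.
- by rewrite /thead (tnth_nth 0) => -[].
- by rewrite (tnth_nth 0) => -[].
- by rewrite /thead (tnth_nth 0) => -[].
- case: ifP => // /allP w_pos f_run.
  exists [tuple (run (g i) t v).-1 | i < m].
    move=> i; rewrite tnth_mktuple; apply: IHg; rewrite prednK //.
    by apply/w_pos/map_f/mem_enum.
  by apply: IHf; rewrite -f_run -map_comp.
- rewrite /thead (tnth_nth 0) /=.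
  elim: (nth 0 v 0) y => [|j IHj] y /=; first by move=> ?; apply: IHf.
  case: ifP => // z_pos g_run.
  exists (run (Prec f g) t (j :: behead v)).-1.
    by apply: IHj; rewrite prednK.
  exact: IHg.
- case: (leastP (fun k => 1 < run f t (k :: v)) t) => _ lt_run _.
  case: eqP => // y_run [<-]; split; first exact: IHf.
  move=> j /lt_run j_run; exists (run f t (j :: v)).-2; apply: IHf.
  by case: (run _ _ _) j_run => [|[]].
Qed.

Lemma run_complete n (c : rec Q n) (v : n.-tuple nat) y :
  eval O c v y -> exists t, run c t v = y.+1.
Proof.
have mono k (c' : rec Q k) w t t' z :
    run c' t w = z.+1 -> t <= t' -> run c' t' w = z.+1.
  by move=> t_run le_tt'; rewrite (run_mono le_tt') t_run.
elim: c v y => [k||k i|q|m k f IHf g IHg|k f IHf g IHg|k f IHf] v y /=.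
- by move=> ->; exists 0.
- by move=> ->; exists 0; rewrite /thead (tnth_nth 0).
- by move=> ->; exists 0; rewrite (tnth_nth 0).
- by move=> ->; exists 0; rewrite /thead (tnth_nth 0).
- move=> [w wP /IHf[tf f_run]].
  have /choice[tg g_run] i := IHg i _ _ (wP i).
  exists (maxn tf (\max_i tg i)).
  have -> : [seq run (g i) (maxn tf (\max_i tg i)) v | i <- enum 'I_m] =
            map succn w.
    rewrite -[w in RHS](_ : mktuple (tnth w) = w) /=; last first.
      by apply: eq_from_tnth => i; rewrite tnth_mktuple.
    rewrite -map_comp; apply: eq_map => i /=; apply: mono (g_run i) _.
    by rewrite leq_max (leq_bigmax i) orbT.
  rewrite all_map all_predT -map_comp map_id_in //.
  exact: mono f_run (leq_maxl _ _).
- rewrite /thead (tnth_nth 0) /=.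
  elim: (nth 0 v 0) y => [|j IHj] y /=; first exact: IHf.
  move=> [z /IHj[t t_run] /IHg[t' t'_run]]; exists (maxn t t').
  have z_run := mono _ (Prec f g) (j :: behead v) _ _ _ t_run (leq_maxl t t').
  by rewrite [iteri _ _ _]z_run /=; apply: mono t'_run (leq_maxr _ _).
- move=> [/IHf[t t_run] lt_y].
  have /choice[T T_run] (j : 'I_y) : exists t, 1 < run f t ((j : nat) :: v).
    have [z /IHf[t' /= t'_run]] := lt_y j (ltn_ord j).
    by exists t'; rewrite t'_run.
  pose t' := maxn (maxn t y) (\max_k T k).
  have le_t : t <= t' by rewrite !leq_max leqnn.
  have le_y : y <= t' by rewrite !leq_max leqnn orbT.
  exists t'; rewrite (@least_eq _ _ y) //.
  + by rewrite (mono _ _ _ _ _ _ t_run le_t).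
  + move=> j lt_j; have := T_run (Ordinal lt_j) => /= j_run.
    rewrite (run_mono _ (ltnW j_run)) //.
    by rewrite leq_max (leq_bigmax (Ordinal lt_j)) orbT.
  + by rewrite (mono _ _ _ _ _ _ t_run le_t).
Qed.

Lemma eval_run n (c : rec Q n) (v : n.-tuple nat) y :
  eval O c v y <-> exists t, run c t v = y.+1.
Proof. by split=> [/run_complete | [t /run_sound]]. Qed.

End Clock.

(** The number of steps is the first argument, in front of the arguments of
    [c]; every case has to carry it into a context of the right shape. *)
Lemma recursive_run D Q (O : D -> Q -> nat -> nat) n (c : rec Q n) :
  recursive O n.+1 (fun d w => run (O d) c (nth 0 w 0) (behead w)).
Proof.
have var m i : i < m -> recursive O m (fun _ v => nth 0 v i).
  exact: recursive_var.
elim: c => [k||k i|q|m k f IHf g IHg|k f IHf g IHg|k f IHf] /=.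
- exact: recursive_const.
- exact: (recursive_behead (recursive_succ (recursive_succ (var 1 0 isT)))).
- exact: (recursive_behead (recursive_succ (var k i (ltn_ord i)))).
- exact: (recursive_behead (recursive_succ (recursive_ask O q))).
- pose gs := [seq (fun d w => (run (O d) (g i) (nth 0 w 0) (behead w)).-1)
             | i <- enum 'I_m].
  have fP : recursive O k.+1 (fun d w => run (O d) f (nth 0 w 0)
      [seq g d w | g <- gs]).
    have hP : recursive O (size ((fun _ w => nth 0 w 0) :: gs))
        (fun d w => run (O d) f (nth 0 w 0) (behead w)).
      by rewrite /= size_map size_enum_ord.
    refine (recursive_comp hP _) => -[_|i]; first exact: var.
    rewrite ltnS -/(size gs) /gs size_map => lt_i; have lt_im := lt_i.
    rewrite size_enum_ord in lt_im; rewrite /= (nth_map (Ordinal lt_im)) //.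
    exact/recursive_pred/IHg.
  apply: recursive_if (recursive_const _ _ 0).
    exact: recursive_all_pos.
  apply: recursive_ext fP => d w _; congr (run _ _ _ _).
  by rewrite -!map_comp.
- have fP : recursive O k.+2
      (fun d w => run (O d) f (nth 0 w 0) (behead (behead w))).
    refine (@recursive_env _ _ O k 2 _ [:: fun _ w => nth 0 w 0] IHf _).
    by case=> // _; apply: var.
  (* The step of the recursion sees the counter, the previous value, the number
     of steps and the recursion argument, in this order, before the rest. *)
  have gP : recursive O k.+4 (fun d w => run (O d) g (nth 0 w 2)
      [:: nth 0 w 0, (nth 0 w 1).-1 & iter 4 behead w]).
    refine (@recursive_env _ _ O k 4 _ [:: fun _ w => nth 0 w 2;
      fun _ w => nth 0 w 0; fun _ w => (nth 0 w 1).-1] IHg _).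
    by do 3?[case=> [_|]] => //; do ?apply: recursive_pred; apply: var.
  have := recursive_prec (var k.+2 1 isT) fP (recursive_if
    (recursive_pos (var k.+4 1 isT)) gP (recursive_const _ _ 0)).
  by apply: recursive_ext => d w _ /=; rewrite nth_behead.
- have fP : recursive O k.+2 (fun d w => run (O d) f (nth 0 w 1)
      (nth 0 w 0 :: iter 2 behead w)).
    refine (@recursive_env _ _ O k 2 _ [:: fun _ w => nth 0 w 1;
      fun _ w => nth 0 w 0] IHf _).
    by do 2?[case=> [_|]] => //; apply: var.
  have yP := recursive_least (var k.+1 0 isT)
    (recursive_leq (recursive_const O _ 2) fP).
  apply: recursive_if (recursive_eq _ (recursive_const _ _ 1))
    (recursive_succ yP) (recursive_const _ _ 0).
  refine (@recursive_env _ _ O k 1 _ [:: fun _ w => nth 0 w 0; _] IHf _).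
  by do 2?[case=> [_|]] => //; apply: var.
Qed.

(** * Pairs of numbers *)

(** As [i] is less than [2 * (i + j) + 1], the code lies between the squares of
    [i + j] and [(i + j).+1], so its integer square root recovers [i + j]. *)
Definition pairing (i j : nat) : nat := (i + j) * (i + j) + i.

Definition isqrt (c : nat) : nat := least (fun z => z.+1 * z.+1 <= c) c.
Definition unpair1 (c : nat) : nat := c - isqrt c * isqrt c.
Definition unpair2 (c : nat) : nat := isqrt c - unpair1 c.

Lemma isqrt_pairing i j : isqrt (pairing i j) = i + j.
Proof.
rewrite /isqrt /pairing; apply: least_eq => [|k lt_k|].
- case: (i + j) => // k; apply: leq_trans (leq_addr _ _).
  by rewrite leq_pmull.
- by apply: leq_trans (leq_addr _ _); apply: leq_mul.
- rewrite -ltnNge mulSn mulnS addSn ltnS addnA [leqRHS]addnC.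
  by rewrite leq_add2l -addnA leq_addr.
Qed.

Lemma pairingK1 i j : unpair1 (pairing i j) = i.
Proof. by rewrite /unpair1 isqrt_pairing addKn. Qed.

Lemma pairingK2 i j : unpair2 (pairing i j) = j.
Proof. by rewrite /unpair2 isqrt_pairing pairingK1 addKn. Qed.

Section Pairing.

Variables (D Q : Type) (O : D -> Q -> nat -> nat) (n : nat).

Lemma recursive_pairing a b : recursive O n a -> recursive O n b ->
  recursive O n (fun d v => pairing (a d v) (b d v)).
Proof.
move=> aP bP; have abP := recursive_add aP bP.
exact: recursive_add (recursive_mul abP abP) aP.
Qed.

Lemma recursive_isqrt a :
  recursive O n a -> recursive O n (fun d v => isqrt (a d v)).
Proof.
move=> aP; have zP := recursive_succ (recursive_var O (isT : 0 < n.+1)).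
exact: recursive_least aP
  (recursive_leq (recursive_mul zP zP) (recursive_behead aP)).
Qed.

Lemma recursive_unpair1 a :
  recursive O n a -> recursive O n (fun d v => unpair1 (a d v)).
Proof.
move=> aP; have rP := recursive_isqrt aP.
exact: recursive_sub aP (recursive_mul rP rP).
Qed.

Lemma recursive_unpair2 a :
  recursive O n a -> recursive O n (fun d v => unpair2 (a d v)).
Proof.
move=> aP; exact: recursive_sub (recursive_isqrt aP) (recursive_unpair1 aP).
Qed.

End Pairing.

(** * Programs for an acceptable numbering *)

Section Numbering.

Variables (phi : nat -> nat -> option nat) (phi_acceptable : acceptable phi).

(** The partial functions needed are all of this form: wait for the first [t]
    that passes a decidable test and compute the output from it. *)
Lemma smn_search (g : nat -> nat -> nat -> bool)
    (h : nat -> nat -> nat -> nat) :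
  recursive0 3 (fun _ v => g (nth 0 v 0) (nth 0 v 1) (nth 0 v 2)) ->
  recursive0 3 (fun _ v => h (nth 0 v 0) (nth 0 v 1) (nth 0 v 2)) ->
  exists2 s, computable s & forall c x,
    if phi (s c) x is Some y then exists2 t, g c x t & y = h c x t
    else forall t, ~~ g c x t.
Proof.
move=> gP hP; have [_ smn] := phi_acceptable.
pose psi c x := if pselect (exists t, g c x t) is left ex_t
  then Some (h c x (ex_minn ex_t)) else None.
have /smn[s s_comp sP] : partial_computable2 psi.
  have var i (lt_i3 : i < 3) := recursive_var (fun _ : unit => no_oracle) lt_i3.
  have gP' := recursive_app3 (F := fun _ c x t => g c x t : nat) gP
    (var 1 isT) (var 2 isT) (var 0 isT).
  have [cg cgP] := eval_least gP'; have [ch chP] := hP.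
  exists (Comp ch (fun i => nth cg [:: Proj ord0; Proj (lift ord0 ord0)] i)).
  move=> c x y /=; rewrite /psi; split.
    case: pselect => // ex_t [<-].
    case: ex_minnP => t gt min_t.
    exists [tuple c; x; t]; last exact/(chP tt).
    case=> -[|[|[|//]]] lt_i //=; apply/(cgP tt); split=> // k.
    by rewrite ltnNge; apply: contra => /min_t.
  move=> [w wP /(chP tt) ->].
  have := wP (lift ord0 (lift ord0 ord0)); rewrite (tnth_nth 0) /=.
  move=> /(cgP tt) /= [gt lt_t].
  have := wP (lift ord0 ord0); rewrite (tnth_nth 0) /= => ->.
  have := wP ord0; rewrite (tnth_nth 0) /= => ->.
  rewrite !(tnth_nth 0) /=.
  case: pselect => [ex_t|]; last by case; exists (nth 0 w 2).
  congr (Some (h _ _ _)); case: ex_minnP => t gt' min_t.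
  apply/eqP; rewrite eqn_leq min_t //= leqNgt.
  by apply/negP => /lt_t; rewrite gt'.
exists s => // c x; rewrite sP /psi; case: pselect => [ex_t | no_t].
  by case: ex_minnP => t gt _; exists t.
by move=> t; apply/negP => gt; apply: no_t; exists t.
Qed.

Lemma recursive0_computable s :
  computable s -> recursive0 1 (fun _ v => s (nth 0 v 0)).
Proof.
move=> [c cP]; exists c => -[] v y; case/tupleP: v => x v.
rewrite (tuple0 v) -[X in eval _ _ X _](_ : [tuple x] = _).
  by rewrite -cP /=; split=> [[]|->].
exact/val_inj.
Qed.

(** The smn property provides indices with a single parameter, hence the pairing
    function. *)
Lemma smn_search2 (g : nat -> nat -> nat -> nat -> bool)
    (h : nat -> nat -> nat -> nat -> nat) :
  recursive0 4
    (fun _ v => g (nth 0 v 0) (nth 0 v 1) (nth 0 v 2) (nth 0 v 3)) ->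
  recursive0 4
    (fun _ v => h (nth 0 v 0) (nth 0 v 1) (nth 0 v 2) (nth 0 v 3)) ->
  exists2 s, recursive0 2 (fun _ v => s (nth 0 v 0) (nth 0 v 1)) &
    forall i j x, if phi (s i j) x is Some y
      then exists2 t, g i j x t & y = h i j x t
      else forall t, ~~ g i j x t.
Proof.
move=> gP hP.
have var n i (lt_in : i < n) := recursive_var (fun _ : unit => no_oracle) lt_in.
have unpaired (f : nat -> nat -> nat -> nat -> nat) :
    recursive0 4
      (fun _ v => f (nth 0 v 0) (nth 0 v 1) (nth 0 v 2) (nth 0 v 3)) ->
    recursive0 3 (fun _ v => f (unpair1 (nth 0 v 0)) (unpair2 (nth 0 v 0))
      (nth 0 v 1) (nth 0 v 2)).
  move=> fP; refine (recursive_comp (n := 3) (gs := [::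
    fun _ v => unpair1 (nth 0 v 0); fun _ v => unpair2 (nth 0 v 0);
    fun _ v => nth 0 v 1; fun _ v => nth 0 v 2]) fP _).
  do 4?[case=> [_|]] => //=; try exact: var.
    exact: recursive_unpair1 (var _ _ _).
  exact: recursive_unpair2 (var _ _ _).
have [s s_comp sP] := smn_search
  (g := fun c => g (unpair1 c) (unpair2 c))
  (h := fun c => h (unpair1 c) (unpair2 c))
  (unpaired (fun i j x t => g i j x t) gP) (unpaired h hP).
exists (fun i j => s (pairing i j)).
  exact: (recursive_app1 (F := fun _ => s) (recursive0_computable s_comp)
    (recursive_pairing (var 2 0 isT) (var 2 1 isT))).
by move=> i j x; have := sP (pairing i j) x; rewrite pairingK1 pairingK2.
Qed.

(** The Kleene normal form of the universal function, with the coding of outputs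
    of [run]. *)
Lemma computable_step_function :
  exists2 T : nat -> nat -> nat -> nat,
    recursive0 3 (fun _ v => T (nth 0 v 0) (nth 0 v 1) (nth 0 v 2)) &
    (forall e x y, phi e x = Some y <-> exists t, T e x t = y.+1) /\
    (forall e x t t', t <= t' -> 0 < T e x t -> T e x t' = T e x t).
Proof.
have [[u uP] _] := phi_acceptable.
exists (fun e x t => run no_oracle u t [:: e; x]).
  have var i (lt_i3 : i < 3) := recursive_var (fun _ : unit => no_oracle) lt_i3.
  refine (recursive_comp (gs := [:: fun _ v => nth 0 v 2;
    fun _ v => nth 0 v 0; fun _ v => nth 0 v 1]) (recursive_run _ u) _).
  by do 3?[case=> [_|]] => //; apply: var.
split=> [e x y | e x t t' le_tt']; last exact: run_mono.
by rewrite uP eval_run.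
Qed.

(** As [K] is 0 by default on an empty set of indices, the bound is meaningful
    only because every computable sequence has an index: by the smn property
    applied to a function that ignores its first argument. *)
Lemma G_ge_candidate p m : pdom (G_ge phi) (p, m) ->
  exists2 k, k <= m & G phi p k.
Proof.
move=> [/= [c cP] le_Km]; exists (K phi p) => //.
have [_ smn] := phi_acceptable.
have [|s _ sP] := smn (fun _ x => Some (p x)).
  exists (Comp c (fun=> Proj (lift ord0 ord0))) => i x y /=; split.
    move=> /cP px; exists [tuple x] => // j.
    by rewrite ord1.
  move=> [w wP cw]; apply/cP; move: (wP ord0) cw.
  rewrite (tnth_nth 0) /=; case/tupleP: w wP => z w _ /= ->.
  by rewrite (tuple0 w) => /=; congr eval; apply/val_inj.
have ex_G : exists k, `[< G phi p k >].
  by exists (s 0); apply/asboolP => x; rewrite sP.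
have [k /asboolP Gk min_k] := ex_minnP ex_G.
rewrite /K /min_set; case: xgetP => [_ _ [] //|/(_ k)[]].
by split=> // i Gi; apply: min_k; apply/asboolP.
Qed.

(** Dovetailing: the first of the two computations that halts gives the value,
    so the new function is a subset of the union of the two graphs and has the
    union of their domains as its domain. *)
Lemma union_index :
  exists2 a, recursive0 2 (fun _ v => a (nth 0 v 0) (nth 0 v 1)) &
    forall i j x, if phi (a i j) x is Some y
      then phi i x = Some y \/ phi j x = Some y
      else phi i x = None /\ phi j x = None.
Proof.
have [T T_rec [TP _]] := computable_step_function.
have var n i (lt_in : i < n) := recursive_var (fun _ : unit => no_oracle) lt_in.
have Ti_rec := recursive_app3 (F := fun _ => T) T_rec (var 4 0 isT)
  (var 4 2 isT) (var 4 3 isT).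
have Tj_rec := recursive_app3 (F := fun _ => T) T_rec (var 4 1 isT)
  (var 4 2 isT) (var 4 3 isT).
have [a a_rec aP] := smn_search2
  (g := fun i j x t => (0 < T i x t) || (0 < T j x t))
  (h := fun i j x t => if 0 < T i x t then (T i x t).-1 else (T j x t).-1)
  (recursive_or (recursive_pos Ti_rec) (recursive_pos Tj_rec))
  (recursive_if (recursive_pos Ti_rec) (recursive_pred Ti_rec)
    (recursive_pred Tj_rec)).
exists a => // i j x; have := aP i j x.
case: (phi _ _) => [y [t] | no_t].
  case: ifP => /= [Ti _ -> | _ Tj ->]; [left | right]; apply/TP; exists t;
    by rewrite prednK.
split.
  case phi_ix: (phi i x) => [y|//]; have /TP[t Tt] := phi_ix.
  by have := no_t t; rewrite Tt.
case phi_jx: (phi j x) => [y|//]; have /TP[t Tt] := phi_jx.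
by have := no_t t; rewrite Tt orbT.
Qed.

(** Disagreement of two partial computable functions is semidecidable, and
    hence is one question to the halting problem.  A witness [n] codes a point
    and a number of steps in which both computations halt there with different
    values; [value i n] is read off the computation found, so that comparing it
    with a sequence involves no further partial function. *)
Lemma disagreement_index :
  exists query (conflict : nat -> nat -> nat -> bool) value,
  [/\ recursive0 2 (fun _ v => query (nth 0 v 0) (nth 0 v 1)),
      recursive0 3 (fun _ v => conflict (nth 0 v 0) (nth 0 v 1) (nth 0 v 2)) &
      recursive0 2 (fun _ v => value (nth 0 v 0) (nth 0 v 1))] /\
  [/\ forall i j, halting phi (query i j) <-> exists n, conflict i j n,
      forall i j x y z, phi i x = Some y -> phi j x = Some z -> y <> z ->
        exists n, conflict i j n &
      forall i j n, conflict i j n -> phi i (unpair1 n) = Some (value i n) /\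
        exists2 z, phi j (unpair1 n) = Some z & value i n <> z].
Proof.
have [T T_rec [TP T_mono]] := computable_step_function.
have var n i (lt_in : i < n) := recursive_var (fun _ : unit => no_oracle) lt_in.
pose S i n := T i (unpair1 n) (unpair2 n).
have S_rec : recursive0 2 (fun _ v => S (nth 0 v 0) (nth 0 v 1)).
  exact: (recursive_app3 (F := fun _ => T) T_rec (var 2 0 isT)
    (recursive_unpair1 (var 2 1 isT)) (recursive_unpair2 (var 2 1 isT))).
pose conflict i j n := [&& 0 < S i n, 0 < S j n & S i n != S j n].
have conflict_rec m i j n (lt_im : i < m) (lt_jm : j < m) (lt_nm : n < m) :
    recursive0 m (fun _ v => conflict (nth 0 v i) (nth 0 v j) (nth 0 v n)).
  have Si := recursive_app2 (F := fun _ => S) S_rec (var m i lt_im)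
    (var m n lt_nm).
  have Sj := recursive_app2 (F := fun _ => S) S_rec (var m j lt_jm)
    (var m n lt_nm).
  exact: recursive_and (recursive_pos Si) (recursive_and (recursive_pos Sj)
    (recursive_neg (recursive_eq Si Sj))).
have [query query_rec queryP] := smn_search2 (h := fun _ _ _ _ => 0)
  (g := fun i j _ n => conflict i j n)
  (@conflict_rec 4 0 1 3 isT isT isT) (recursive_const _ _ 0).
exists query, conflict, (fun i n => (S i n).-1); split.
  by split=> //; [exact: (@conflict_rec 3 0 1 2) | exact: recursive_pred].
split=> [i j | i j x y z /TP[t Tt] /TP[t' Tt'] neq_yz | i j n].
- rewrite /halting /=; have := queryP i j (query i j).
  case: (phi _ _) => [y [n cn _] | no_c]; first by split=> // _; exists n.
  by split=> // -[n]; rewrite (negPf (no_c n)).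
- exists (pairing x (maxn t t')); rewrite /conflict /S pairingK1 pairingK2.
  rewrite (T_mono _ _ _ _ (leq_maxl t t')) ?Tt //.
  rewrite (T_mono _ _ _ _ (leq_maxr t t')) ?Tt' //=.
  by rewrite eqSS; apply/eqP.
- move=> /and3P[Si Sj /eqP neq_S]; split.
    by apply/TP; exists (unpair2 n); rewrite prednK.
  exists (S j n).-1; first by apply/TP; exists (unpair2 n); rewrite prednK.
  by move=> eq_S; apply: neq_S; rewrite -(prednK Si) eq_S prednK.
Qed.

(** At a point of disagreement, comparing [phi i] with [p] discards an index
    that is wrong; without such a point, the union of the two functions is [p] as
    soon as one of them is. *)
Lemma merge_indices : exists2 merge : (nat -> nat) -> nat -> nat -> nat,
  recursive (fun p => oracles p (halting phi)) 2
    (fun p v => merge p (nth 0 v 0) (nth 0 v 1)) &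
  forall p i j, G phi p i \/ G phi p j -> G phi p (merge p i j).
Proof.
have [union union_rec unionP] := union_index.
have [query [conflict [value [[query_rec conflict_rec value_rec]]]]] :=
  disagreement_index.
move=> [queryP conflict_complete conflict_sound].
pose O p := oracles p (halting phi).
have var n i (lt_in : i < n) := recursive_var O lt_in.
pose H i j := `[< halting phi (query i j) >].
(* The position [n] is 0 in the context of [merge], and 1 in that of the search,
   whose counter comes first. *)
have H_rec n : recursive O n.+2 (fun p v => H (nth 0 v n) (nth 0 v n.+1)).
  apply: (@recursive_app1 _ _ O (fun _ => charf (halting phi))).
    exact: (recursive_ask O Aux).
  apply: (@recursive_app2 _ _ O (fun _ => query)); try exact: var.
  exact: recursive0_recursive.
(* The first disjunct makes the search total: without a conflict any witness
   will do. *)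
have [|p v|w w_rec wP] := @recursive_search _ _ O 2 (fun p v =>
    ~~ H (nth 0 v 1) (nth 0 v 2)
    || conflict (nth 0 v 1) (nth 0 v 2) (nth 0 v 0)).
- apply: recursive_or (recursive_neg (H_rec 1)) _.
  exact: (recursive_app3 (F := fun _ i j n => conflict i j n : nat)
    (recursive0_recursive O conflict_rec) (var 3 1 isT) (var 3 2 isT)
    (var 3 0 isT)).
- have [/queryP[n cn] | no_halt] :=
    pselect (halting phi (query (nth 0 v 0) (nth 0 v 1))).
    by exists n; rewrite cn orbT.
  by exists 0; rewrite /= /H asboolF.
exists (fun p i j => let n := w p [:: i; j] in
  if H i j then if value i n == p (unpair1 n) then i else j else union i j).
  have v_rec := recursive_app2 (F := fun _ => value)
    (recursive0_recursive O value_rec) (var 2 0 isT) w_rec.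
  have p_rec := recursive_app1 (F := id) (recursive_ask O Input)
    (recursive_unpair1 w_rec).
  have := recursive_if (H_rec 0)
    (recursive_if (recursive_eq v_rec p_rec) (var 2 0 isT) (var 2 1 isT))
    (recursive0_recursive O union_rec).
  by apply: recursive_ext => p v; case: v => [|i [|j []]].
move=> p i j Gij; have := wP p [:: i; j]; rewrite /= /H.
case: asboolP => [_ /= | no_conflict _].
  move=> /conflict_sound[phi_i [z phi_j neq_z]].
  case: eqP => value_p; case: Gij => // Gk.
    by rewrite Gk in phi_j; case: phi_j neq_z => <- /(_ value_p).
  by rewrite Gk in phi_i; case: phi_i value_p => ->.
have agree x y z : phi i x = Some y -> phi j x = Some z -> y = z.
  move=> phi_i phi_j; apply: contra_notP no_conflict => neq_yz.
  by apply/queryP; apply: conflict_complete phi_i phi_j neq_yz.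
move=> x; have := unionP i j x; case: (phi (union i j) x) => [y|].
  case: Gij => /(_ x) phi_p [phi_y|phi_y].
  - by rewrite -phi_y.
  - by rewrite (agree _ _ _ phi_p phi_y).
  - by rewrite (agree _ _ _ phi_y phi_p).
  - by rewrite -phi_y.
by case: Gij => Gk; rewrite Gk => -[].
Qed.

End Numbering.

Theorem proposition18 (phi : nat -> nat -> option nat)
    (phi_acceptable : acceptable phi) :
  computable_relative_to (halting phi) (G_ge phi).
Proof.
have [merge merge_rec mergeP] := merge_indices phi_acceptable.
pose fold p m := iteri m (fun k i => merge p i k.+1) 0.
exists (fun pm => Some (fold pm.1 pm.2)).
  pose O p := oracles p (halting phi).
  have var n i (lt_in : i < n) := recursive_var O lt_in.
  have [c cP] := recursive_prec (var 1 0 isT) (recursive_const O 1 0)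
    (recursive_app2 merge_rec (var 3 1 isT) (recursive_succ (var 3 0 isT))).
  by exists c => p m y; rewrite cP /=; split=> [[] | ->].
move=> [p m] /(G_ge_candidate phi_acceptable)[k le_km Gk] /=.
exists (fold p m) => //; elim: m le_km => [|m IHm].
  by rewrite leqn0 => /eqP k0; rewrite k0 in Gk.
rewrite leq_eqVlt => /predU1P[def_k | /IHm Gm]; apply: mergeP; last by left.
by right; rewrite -def_k.
Qed.
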